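(* Let $\mathcal{C}$ be a $k$-linear Reedy category with degree function $\deg\colon\operatorname{Obj}(\mathcal{C})\to\lambda$, let $c$ be an object in $\mathcal{C}$ of degree $\alpha$, and let $\beta\leq\lambda$ be an ordinal. Then the left $\mathcal{C}_{<\beta}$-module $\mathcal{C}(c,-)|_{\mathcal{C}_{<\beta}}$ is filtered by standard functors from $\mathcal{K}^{\mathcal{C}_{<\beta}}$ corresponding to objects of degrees $<\min(\alpha+1,\beta)$.
   Context: $k$ is a field and $\mathcal{K}$ is the category of $k$-vector spaces. A small $k$-linear category $\mathcal{D}$ is called direct (resp. inverse) if $\operatorname{End}_{\mathcal{D}}(c)\cong k$ for every object $c$, and there are an ordinal $\lambda$ and a function $\deg\colon\operatorname{Obj}(\mathcal{D})\to\lambda$ such that every non-zero non-endomorphism $c\to c'$ satisfies $\deg(c)<\deg(c')$ (resp. $\deg(c)>\deg(c')$). A small $k$-linear category $\mathcal{C}$ is called $k$-linear Reedy if there are an ordinal $\lambda$, a function $\deg\colon\operatorname{Obj}(\mathcal{C})\to\lambda$, and two $k$-linear subcategories $\mathcal{C}^+,\mathcal{C}^-$ of $\mathcal{C}$ with the same objects as $\mathcal{C}$, with $\mathcal{C}^+$ direct and $\mathcal{C}^-$ inverse with respect to the same function $\deg$, such that for all objects $c,d$ composition induces a $k$-linear isomorphism $\bigoplus_{e\in\operatorname{Obj}(\mathcal{C})}\mathcal{C}^+(e,d)\otimes_k\mathcal{C}^-(c,e)\cong\mathcal{C}(c,d)$. These data are fixed. For an ordinal $\beta\le\lambda$, $\mathcal{C}_{<\beta}$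 is the full subcategory of $\mathcal{C}$ on the objects of degree $<\beta$; it is again $k$-linear Reedy with the restricted degree function, and with $(\mathcal{C}_{<\beta})^{\pm}$ the full subcategories of $\mathcal{C}^{\pm}$ on the objects of degree $<\beta$. $\mathcal{K}^{\mathcal{D}}$ is the category of left $\mathcal{D}$-modules, i.e. $k$-linear functors $\mathcal{D}\to\mathcal{K}$. For a $k$-linear Reedy category $\mathcal{D}$, an ordinal $\alpha$ and objects $c,d$, let $\mathcal{I}^{\mathcal{D}}_{<\alpha}(c,d)\subseteq\mathcal{D}(c,d)$ be the image of the composition map $\bigoplus_{\deg(e)<\alpha}\mathcal{D}^+(e,d)\otimes_k\mathcal{D}^-(c,e)\to\mathcal{D}(c,d)$; this defines a two-sided ideal. The standard functor (standard left $\mathcal{D}$-module) corresponding to an object $c$ of degree $\alpha$ is $\Delta_c:=\mathcal{D}(c,-)/\mathcal{I}^{\mathcal{D}}_{<\alpha}(c,-)$. A module $M$ is filtered by a class $\mathcal{X}$ of modules if there are an ordinal $\sigma$ and a chain of submodules $0=M_0\subseteq M_1\subseteq\cdots\subseteq M_\sigma=M$ indexed by the ordinals $\le\sigma$, with $M_\gamma=\bigcup_{\delta<\gamma}M_\delta$ for limit ordinals $\gamma\le\sigma$ and each $M_{\delta+1}/M_\delta$ ($\delta<\sigma$) isomorphic to a module in $\mathcal{X}$. *)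

(* Defs.v *)
From HB Require Import structures.
From mathcomp Require Import all_boot all_algebra finmap.
From mathcomp Require Import boolp classical_sets functions cardinality fsbigop.
From mathcomp Require Import wochoice.

Set Implicit Arguments.
Unset Strict Implicit.
Unset Printing Implicit Defensive.

Import GRing.Theory.

Local Open Scope ring_scope.
Local Open Scope quotient_scope.
Local Open Scope classical_set_scope.

Record subspace (k : fieldType) (V : lmodType k) := Subspace {
  subspace_pred :> {pred V};
  subspace_closed : submod_closed subspace_pred }.

HB.instance Definition _ (k : fieldType) (V : lmodType k) (W : subspace V) :=
  GRing.isSubmodClosed.Build k V (subspace_pred W) (subspace_closed W).

Definition sub_space (k : fieldType) (V : lmodType k) (W : subspace V) : Type :=
  {x : V | x \in subspace_pred W}.

Section SubSpace.
Variables (k : fieldType) (V : lmodType k) (W : subspace V).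
HB.instance Definition _ := SubChoice.on (sub_space W).
HB.instance Definition _ :=
  [SubChoice_isSubLmodule of sub_space W by <:].
End SubSpace.

Definition quot_space (k : fieldType) (V : lmodType k) (W : subspace V) : Type :=
  @Quotient.quot V (subspace_pred W).

Section QuotSpace.
Variables (k : fieldType) (V : lmodType k) (W : subspace V).
HB.instance Definition _ := EqQuotient.on (quot_space W).
HB.instance Definition _ := ZmodQuotient.on (quot_space W).

Definition quot_pi (x : V) : quot_space W := \pi_(quot_space W) x.

Lemma quot_piK (x : quot_space W) : quot_pi (repr x) = x.
Proof. exact: reprK. Qed.

Lemma quot_piE (x y : V) : (quot_pi x == quot_pi y) = (x - y \in subspace_pred W).
Proof. by rewrite [RHS]Quotient.idealrBE. Qed.

Lemma quot_piD (x y : V) : quot_pi (x + y) = quot_pi x + quot_pi y.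
Proof. exact: raddfD. Qed.

Definition quot_scale (a : k) (x : quot_space W) : quot_space W :=
  quot_pi (a *: repr x).

Lemma quot_scaleE a (x : V) : quot_scale a (quot_pi x) = quot_pi (a *: x).
Proof.
apply/eqP; rewrite quot_piE -scalerBr rpredZ // -quot_piE quot_piK.
exact: eqxx.
Qed.

Lemma quot_scaleA a b x : quot_scale a (quot_scale b x) = quot_scale (a * b) x.
Proof. by rewrite -[x]quot_piK !quot_scaleE scalerA. Qed.
Lemma quot_scale1 : left_id 1 quot_scale.
Proof. by move=> x; rewrite -[x]quot_piK !quot_scaleE scale1r. Qed.
Lemma quot_scaleDr : right_distributive quot_scale +%R.
Proof.
move=> a x y; rewrite -[x]quot_piK -[y]quot_piK.
by rewrite -quot_piD !quot_scaleE scalerDr quot_piD.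
Qed.
Lemma quot_scaleDl x : {morph quot_scale^~ x : a b / a + b}.
Proof. by move=> a b; rewrite -[x]quot_piK !quot_scaleE scalerDl quot_piD. Qed.

HB.instance Definition _ := GRing.Zmodule_isLmodule.Build k (quot_space W)
  quot_scaleA quot_scale1 quot_scaleDr quot_scaleDl.

Lemma quot_pi_linear : linear quot_pi.
Proof. by move=> a x y; rewrite quot_piD -quot_scaleE. Qed.
HB.instance Definition _ :=
  GRing.isLinear.Build k V (quot_space W) *:%R quot_pi quot_pi_linear.

Lemma quot_pi_eq0 x : (quot_pi x == 0) = (x \in subspace_pred W).
Proof. by rewrite -(linear0 quot_pi) quot_piE subr0. Qed.
End QuotSpace.
Arguments quot_pi {k V} W x.

Definition dprod (k : fieldType) (I : choiceType) (V : I -> lmodType k) : Type :=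
  forall i, V i.

Section DirectProduct.
Variables (k : fieldType) (I : choiceType) (V : I -> lmodType k).
Implicit Types x y z : dprod V.
HB.instance Definition _ := Choice.copy (dprod V) (forall i, V i).

Definition dprod_zero : dprod V := fun i => 0.
Definition dprod_opp x : dprod V := fun i => - x i.
Definition dprod_add x y : dprod V := fun i => x i + y i.
Definition dprod_scale a x : dprod V := fun i => a *: x i.

Lemma dprod_addA : associative dprod_add.
Proof. by move=> x y z; apply: functional_extensionality_dep => i; apply: addrA. Qed.
Lemma dprod_addC : commutative dprod_add.
Proof. by move=> x y; apply: functional_extensionality_dep => i; apply: addrC. Qed.
Lemma dprod_add0 : left_id dprod_zero dprod_add.
Proof. by move=> x; apply: functional_extensionality_dep => i; apply: add0r. Qed.
Lemma dprod_addN : left_inverse dprod_zero dprod_opp dprod_add.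
Proof. by move=> x; apply: functional_extensionality_dep => i; apply: addNr. Qed.
HB.instance Definition _ :=
  GRing.isZmodule.Build (dprod V) dprod_addA dprod_addC dprod_add0 dprod_addN.

Lemma dprod_scaleA a b x : dprod_scale a (dprod_scale b x) = dprod_scale (a * b) x.
Proof. by apply: functional_extensionality_dep => i; apply: scalerA. Qed.
Lemma dprod_scale1 : left_id 1 dprod_scale.
Proof. by move=> x; apply: functional_extensionality_dep => i; apply: scale1r. Qed.
Lemma dprod_scaleDr : right_distributive dprod_scale +%R.
Proof. by move=> a x y; apply: functional_extensionality_dep => i; apply: scalerDr. Qed.
Lemma dprod_scaleDl x : {morph dprod_scale^~ x : a b / a + b}.
Proof. by move=> a b; apply: functional_extensionality_dep => i; apply: scalerDl. Qed.
HB.instance Definition _ := GRing.Zmodule_isLmodule.Build k (dprod V)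
  dprod_scaleA dprod_scale1 dprod_scaleDr dprod_scaleDl.
End DirectProduct.

Section DirectSum.
Variables (k : fieldType) (I : choiceType) (V : I -> lmodType k).

Definition dsum_pred : {pred dprod V} :=
  [pred x : dprod V | `[< finite_set [set i | x i != 0] >]].

Lemma dsum_closed : submod_closed dsum_pred.
Proof.
split=> [|a x y /asboolP fx /asboolP fy]; apply/asboolP.
  by apply: (sub_finite_set _ (finite_set0 I)) => i /=; rewrite eqxx.
apply: (@sub_finite_set _ _ ([set i | x i != 0] `|` [set i | y i != 0])).
  move=> i /=; apply: contraPP => /not_orP[/negP/negPn/eqP xi /negP/negPn/eqP yi].
  apply/negP/negPn/eqP.
  have -> : (a *: x + y) i = a *: x i + y i by [].
  by rewrite xi yi scaler0 addr0.
by rewrite finite_setU.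
Qed.

Definition dsum : Type := sub_space (Subspace dsum_closed).
HB.instance Definition _ := GRing.Lmodule.on dsum.

Definition dsum_fun (x : dsum) : forall i, V i := val x.

Lemma dsum_inj_subproof i (v : V i) :
  (dfwith (fun j => 0 : V j) v : dprod V) \in dsum_pred.
Proof.
apply/asboolP; apply: (sub_finite_set _ (finite_set1 i)) => j /=.
by case: dfwithP => //= ?; rewrite eqxx.
Qed.

Definition dsum_inj i (v : V i) : dsum :=
  exist (fun x : dprod V => x \in dsum_pred) _ (dsum_inj_subproof v).

Definition dsum_lift (U : lmodType k) (f : forall i, V i -> U) (x : dsum) : U :=
  \sum_(i \in [set: I]) f i (dsum_fun x i).

Lemma dsum_ext x y : (forall i, dsum_fun x i = dsum_fun y i) -> x = y.
Proof.
by move=> h; apply: val_inj; apply: functional_extensionality_dep => i; apply: h.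
Qed.

Lemma dsum_finite x : finite_set [set i | dsum_fun x i != 0].
Proof. by apply/asboolP; exact: (valP x). Qed.

Lemma dsum_inj_in i (v : V i) : dsum_fun (dsum_inj v) i = v.
Proof. exact: dfwith_in. Qed.

Lemma dsum_inj_out i j (v : V i) : i != j -> dsum_fun (dsum_inj v) j = 0.
Proof. by move=> ij; rewrite /dsum_fun /= dfwith_out. Qed.

Lemma dsum_funP a x y i : dsum_fun (a *: x + y) i = a *: dsum_fun x i + dsum_fun y i.
Proof. by []. Qed.

Lemma dsum_inj_linear i : linear (@dsum_inj i).
Proof.
move=> a u v; apply: dsum_ext => j; rewrite dsum_funP /dsum_fun /=.
have [<-|nij] := eqVneq i j; first by rewrite !dfwith_in.
by rewrite !dfwith_out // scaler0 addr0.
Qed.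
HB.instance Definition _ i :=
  GRing.isLinear.Build k (V i) dsum *:%R (@dsum_inj i) (@dsum_inj_linear i).

Lemma dsum_funD x y i : dsum_fun (x + y) i = dsum_fun x i + dsum_fun y i.
Proof. by []. Qed.

Lemma dsum_fun_sum (J : eqType) (r : seq J) (F : J -> dsum) i :
  dsum_fun (\sum_(j <- r) F j) i = \sum_(j <- r) dsum_fun (F j) i.
Proof.
elim: r => [|j r IH]; first by rewrite !big_nil.
by rewrite !big_cons dsum_funD IH.
Qed.

Lemma dsum_decomp x (A : {fset I}) : (forall i, i \notin A -> dsum_fun x i = 0) ->
  x = \sum_(i <- A) dsum_inj (dsum_fun x i).
Proof.
move=> hA; apply: dsum_ext => i; rewrite dsum_fun_sum.
have h0 j : j != i -> dsum_fun (dsum_inj (dsum_fun x j)) i = 0.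
  by move=> ji; rewrite /dsum_fun /= dfwith_out.
have [iA|/hA xi] := boolP (i \in A); last first.
  rewrite xi big_seq big1 // => j jA; have [ji|/h0//] := eqVneq j i.
  by rewrite ji xi linear0.
rewrite (big_rem i) //= /dsum_fun /= dfwith_in big_seq big1 ?addr0 // => j.
by rewrite mem_rem_uniq ?fset_uniq // inE => /andP[/h0].
Qed.

Lemma dsum_lift_fset (U : lmodType k) (f : forall i, V i -> U) x (A : {fset I}) :
  (forall i, linear (f i)) -> (forall i, i \notin A -> dsum_fun x i = 0) ->
  dsum_lift f x = \sum_(i <- A) f i (dsum_fun x i).
Proof.
move=> lf hA; rewrite /dsum_lift (fsbigTE A) // => i /hA ->.
pose fi : {linear V i -> U} :=
  HB.pack (f i) (GRing.isLinear.Build k (V i) U *:%R (f i) (lf i)).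
exact: (linear0 fi).
Qed.

Lemma dsum_supp x : exists A : {fset I}, forall i, i \notin A -> dsum_fun x i = 0.
Proof.
exists (fset_set [set i | dsum_fun x i != 0]) => i.
rewrite in_fset_set; last exact: dsum_finite.
by move=> /negP xi; apply/eqP/negP => /negP nx; apply: xi; rewrite inE.
Qed.

Lemma dsum_lift_linear (U : lmodType k) (f : forall i, V i -> U) :
  (forall i, linear (f i)) -> linear (dsum_lift f).
Proof.
move=> lf a x y; have [A hA] := dsum_supp x; have [B hB] := dsum_supp y.
have AB i : i \notin (A `|` B)%fset -> dsum_fun x i = 0 /\ dsum_fun y i = 0.
  by rewrite !inE => /norP[/hA ? /hB ?].
rewrite !(@dsum_lift_fset _ _ _ (A `|` B)%fset) //; try by move=> i /AB[].
  by rewrite scaler_sumr -big_split /=; apply: eq_bigr => i _; rewrite dsum_funP lf.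
by move=> i /AB[xi yi]; rewrite dsum_funP xi yi scaler0 addr0.
Qed.

Lemma dsum_lift_inj (U : lmodType k) (f : forall i, V i -> U) i (v : V i) :
  (forall i, linear (f i)) -> dsum_lift f (dsum_inj v) = f i v.
Proof.
move=> lf; rewrite (@dsum_lift_fset _ _ _ [fset i]%fset) //.
  by rewrite big_seq_fset1 /dsum_fun /= dfwith_in.
by move=> j; rewrite inE => ji; rewrite /dsum_fun /= dfwith_out // eq_sym.
Qed.

Lemma dsum_eq (U : lmodType k) (f g : dsum -> U) : linear f -> linear g ->
  (forall i (v : V i), f (dsum_inj v) = g (dsum_inj v)) -> f =1 g.
Proof.
move=> lf lg fg x; have [A /dsum_decomp ->] := dsum_supp x.
pose f' : {linear dsum -> U} := HB.pack f (GRing.isLinear.Build k dsum U *:%R f lf).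
pose g' : {linear dsum -> U} := HB.pack g (GRing.isLinear.Build k dsum U *:%R g lg).
rewrite -[f]/(f' : _ -> _) -[g]/(g' : _ -> _) !linear_sum.
by apply: eq_bigr => i _; exact: fg.
Qed.
End DirectSum.
Arguments dsum_pred {k I} V.
Arguments dsum_inj {k I} V i v.

Section Span.
Variables (k : fieldType) (V : lmodType k).

Definition span_pred (S : set V) : {pred V} :=
  [pred x | `[< forall W : subspace V,
                  (forall y, S y -> y \in subspace_pred W) ->
                  x \in subspace_pred W >]].

Lemma span_closed (S : set V) : submod_closed (span_pred S).
Proof.
split=> [|a x y /asboolP hx /asboolP hy]; apply/asboolP => W SW.
  exact: rpred0.
by apply: rpredD; [apply: rpredZ; apply: hx | apply: hy].
Qed.

Definition span (S : set V) : subspace V := Subspace (span_closed S).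

Lemma span_sub (S : set V) y : S y -> y \in subspace_pred (span S).
Proof. by move=> Sy; apply/asboolP => W; apply. Qed.
End Span.

Section Tensor.
Variables (k : fieldType) (V W : lmodType k).

Definition free_space (T : choiceType) : lmodType k := dsum (fun _ : T => k^o).

Definition free_gen (T : choiceType) (t : T) : free_space T :=
  dsum_inj (fun _ : T => k^o) t 1.

Definition tensor_rel : set (free_space (V * W)%type) :=
  [set x | (exists a v v' w, x = free_gen (a *: v + v', w)
              - (a *: free_gen (v, w) + free_gen (v', w))) \/
           (exists a v w w', x = free_gen (v, a *: w + w')
              - (a *: free_gen (v, w) + free_gen (v, w')))].

Definition tensor : lmodType k := quot_space (span tensor_rel).

Definition pure (v : V) (w : W) : tensor := quot_pi (span tensor_rel) (free_gen (v, w)).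

Definition free_lift (U : lmodType k) (T : choiceType) (f : T -> U) :
    free_space T -> U :=
  dsum_lift (V := fun _ : T => k^o) (fun t (a : k^o) => (a : k) *: f t).

Definition tensor_lift (U : lmodType k) (b : V -> W -> U) (t : tensor) : U :=
  free_lift (fun p => b p.1 p.2) (repr (t : quot_space (span tensor_rel))).

Lemma free_lift_linear (U : lmodType k) (T : choiceType) (f : T -> U) :
  linear (free_lift f).
Proof.
by apply: dsum_lift_linear => i a x y; rewrite scalerDl scalerA.
Qed.

Lemma free_lift_gen (U : lmodType k) (T : choiceType) (f : T -> U) t :
  free_lift f (free_gen t) = f t.
Proof.
rewrite /free_lift dsum_lift_inj ?scale1r // => i a x y.
by rewrite scalerDl scalerA.
Qed.

Lemma free_genZ (T : choiceType) (t : T) (a : k^o) :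
  dsum_inj (fun _ : T => k^o) t a = a *: free_gen t.
Proof.
have E := linearZZ (dsum_inj (fun _ : T => k^o) t) a 1.
rewrite /free_gen -[RHS]E /=; congr dsum_inj.
by rewrite /(_ *: _) /= mulr1.
Qed.

Lemma pure_linearl w : linear (pure^~ w).
Proof.
move=> a v v'; apply/eqP; rewrite /pure -linearP /= quot_piE.
by apply: span_sub; left; exists a, v, v', w.
Qed.

Lemma pure_linearr v : linear (pure v).
Proof.
move=> a w w'; apply/eqP; rewrite /pure -linearP /= quot_piE.
by apply: span_sub; right; exists a, v, w, w'.
Qed.

Section Lift.
Variables (U : lmodType k) (b : V -> W -> U).
Hypotheses (bl : forall w, linear (b^~ w)) (br : forall v, linear (b v)).

Let F := free_lift (fun p : V * W => b p.1 p.2).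

Lemma tensor_lift_ker x : x \in subspace_pred (span tensor_rel) -> F x = 0.
Proof.
have FP : linear F by exact: free_lift_linear.
pose F' : {linear free_space (V * W)%type -> U} :=
  HB.pack F (GRing.isLinear.Build k _ U *:%R F FP).
pose K := [pred x | F x == 0].
have Kc : submod_closed K.
  split=> [|a u v]; rewrite !inE; first by rewrite -[F]/(F' : _ -> _) linear0.
  by move=> /eqP u0 /eqP v0; rewrite FP u0 v0 scaler0 addr0.
move=> /asboolP/(_ (Subspace Kc)) h; apply/eqP; apply: h => y; rewrite inE.
move=> [[a [v [v' [w ->]]]]|[a [v [w [w' ->]]]]]; rewrite -[F]/(F' : _ -> _).
  by rewrite linearB linearP /= /F !free_lift_gen /= bl subrr.
by rewrite linearB linearP /= /F !free_lift_gen /= br subrr.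
Qed.

Lemma tensor_lift_pi x : tensor_lift b (quot_pi _ x) = F x.
Proof.
have FP : linear F by exact: free_lift_linear.
pose F' : {linear free_space (V * W)%type -> U} :=
  HB.pack F (GRing.isLinear.Build k _ U *:%R F FP).
apply/eqP; rewrite /tensor_lift -/F -[F]/(F' : _ -> _) -subr_eq0 -linearB.
by apply/eqP/tensor_lift_ker; rewrite -quot_piE quot_piK.
Qed.

Lemma tensor_lift_linear : linear (tensor_lift b).
Proof.
move=> a s t; rewrite -[s]quot_piK -[t]quot_piK -linearP !tensor_lift_pi.
exact: free_lift_linear.
Qed.

Lemma tensor_lift_pure v w : tensor_lift b (pure v w) = b v w.
Proof. by rewrite tensor_lift_pi /F free_lift_gen. Qed.
End Lift.

Lemma tensor_eq (U : lmodType k) (f g : tensor -> U) : linear f -> linear g ->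
  (forall v w, f (pure v w) = g (pure v w)) -> f =1 g.
Proof.
move=> lf lg fg t; rewrite -[t]quot_piK.
apply: (@dsum_eq k _ _ U (fun x => f (quot_pi _ x)) (fun x => g (quot_pi _ x))).
- by move=> a x y; rewrite linearP lf.
- by move=> a x y; rewrite linearP lg.
move=> [v w] a; rewrite free_genZ.
pose f' : {linear tensor -> U} := HB.pack f (GRing.isLinear.Build k _ U *:%R f lf).
pose g' : {linear tensor -> U} := HB.pack g (GRing.isLinear.Build k _ U *:%R g lg).
rewrite linearZ -[f]/(f' : _ -> _) -[g]/(g' : _ -> _) !linearZ; congr (_ *: _).
exact: fg.
Qed.
End Tensor.
Arguments free_gen {k T} t.
Arguments pure {k V W} v w.

(* Ordinals are represented by well-ordered types.  The ordinals at most
   [L] are the initial segments of [L]: an element [x] of [L] stands for the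
   ordinal [seg_of x], and [gamma < beta] is [x \in beta] for the [x] with
   [gamma = seg_of x]. *)
Record wotype := WoType {
  wo_sort :> choiceType;
  wo_le : rel wo_sort;
  wo_wellP : well_order wo_le }.

Definition wo_lt (L : wotype) (x y : L) : bool := wo_le x y && (x != y).

Lemma wo_min (L : wotype) (A : {pred L}) x : x \in A ->
  exists2 z, z \in A & forall y, y \in A -> wo_le z y.
Proof.
move=> Ax; have [|z [[Az mz] _]] := @wo_wellP L A; first by exists x.
by exists z.
Qed.

Lemma wo_le_refl (L : wotype) : reflexive (@wo_le L).
Proof.
move=> x; have /wo_min[z] : x \in pred1 x by exact/eqxx.
by rewrite inE => /eqP -> h; apply: h; rewrite inE eqxx.
Qed.

Lemma wo_le_anti (L : wotype) : antisymmetric (@wo_le L).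
Proof.
move=> x y /andP[xy yx].
have [|z [_ uz]] := @wo_wellP L (pred2 x y); first by exists x; rewrite inE eqxx.
rewrite -(uz x) ?(uz y) //; split; rewrite ?inE ?eqxx ?orbT // => t;
  by rewrite inE => /orP[]/eqP ->; rewrite // wo_le_refl.
Qed.

Lemma wo_le_total (L : wotype) : total (@wo_le L).
Proof.
move=> x y; have /wo_min[z] : x \in pred2 x y by rewrite inE eqxx.
rewrite inE => /orP[]/eqP -> h.
  by rewrite h // !inE eqxx orbT.
by rewrite [X in _ || X]h ?orbT // !inE eqxx.
Qed.

Lemma wo_le_trans (L : wotype) : transitive (@wo_le L).
Proof.
move=> y x z xy yz; have /wo_min[t] : x \in pred3 x y z by rewrite inE eqxx.
rewrite inE => /or3P[]/eqP -> h.
- by apply: h; rewrite !inE eqxx !orbT.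
- have yx : wo_le y x by apply: h; rewrite !inE eqxx.
  by have -> : x = y by apply: wo_le_anti; rewrite xy yx.
- have zx : wo_le z y by apply: h; rewrite !inE eqxx !orbT.
  by have <- : y = z by apply: wo_le_anti; rewrite yz zx.
Qed.

Lemma wo_le_lt_trans (L : wotype) (x y z : L) : wo_le x y -> wo_lt y z -> wo_lt x z.
Proof.
move=> xy /andP[yz nyz]; apply/andP; split; first exact: wo_le_trans yz.
apply: contraNneq nyz => xz; apply/eqP/wo_le_anti.
by rewrite yz -xz.
Qed.

Lemma wo_lt_le (L : wotype) (x y : L) : wo_lt x y -> wo_le x y.
Proof. by case/andP. Qed.

Lemma wo_lt_irr (L : wotype) (x : L) : wo_lt x x = false.
Proof. by rewrite /wo_lt eqxx andbF. Qed.

Record segment (L : wotype) := Segment {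
  seg_pred :> {pred L};
  seg_down : forall x y : L, wo_le x y -> y \in seg_pred -> x \in seg_pred }.

Section Segments.
Variable L : wotype.

Lemma seg_zero_down (x y : L) :
  wo_le x y -> y \in (pred0 : {pred L}) -> x \in (pred0 : {pred L}).
Proof. by []. Qed.
Definition seg_zero : segment L := Segment seg_zero_down.

Lemma seg_full_down (x y : L) :
  wo_le x y -> y \in (predT : {pred L}) -> x \in (predT : {pred L}).
Proof. by []. Qed.
Definition seg_full : segment L := Segment seg_full_down.

Lemma seg_of_down (a x y : L) :
  wo_le x y -> y \in ([pred z | wo_lt z a] : {pred L}) -> x \in ([pred z | wo_lt z a] : {pred L}).
Proof. exact: wo_le_lt_trans. Qed.
Definition seg_of (a : L) : segment L := Segment (@seg_of_down a).

Lemma seg_succ_down (a x y : L) :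
  wo_le x y -> y \in ([pred z | wo_le z a] : {pred L}) -> x \in ([pred z | wo_le z a] : {pred L}).
Proof. by move=> xy ya; exact: wo_le_trans ya. Qed.
(* the ordinal [a + 1] *)
Definition seg_succ (a : L) : segment L := Segment (@seg_succ_down a).

Lemma seg_min_down (A B : segment L) (x y : L) : wo_le x y ->
  y \in ([predI A & B] : {pred L}) -> x \in ([predI A & B] : {pred L}).
Proof.
by move=> xy /andP[yA yB]; apply/andP; split; [apply: seg_down yA | apply: seg_down yB].
Qed.
Definition seg_min (A B : segment L) : segment L := Segment (@seg_min_down A B).

Definition seg_limit (A : segment L) : Prop :=
  (exists x, x \in seg_pred A) /\
  (forall x, x \in seg_pred A -> exists2 y, y \in seg_pred A & wo_lt x y).
End Segments.

(* Objects form a [choiceType]; classically every type carries such a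
   structure. *)
Record klincat (k : fieldType) := KLinCat {
  obj :> choiceType;
  hom : obj -> obj -> lmodType k;
  idm : forall c, hom c c;
  comp : forall c d e, hom d e -> hom c d -> hom c e;
  comp_linearl : forall c d e (g : hom c d), linear (fun f : hom d e => comp f g);
  comp_linearr : forall c d e (f : hom d e), linear (fun g : hom c d => comp f g);
  comp_assoc : forall a b c d (f : hom c d) (g : hom b c) (h : hom a b),
    comp f (comp g h) = comp (comp f g) h;
  comp_idl : forall c d (f : hom c d), comp (idm d) f = f;
  comp_idr : forall c d (f : hom c d), comp f (idm c) = f }.
Arguments hom {k k0} c d : rename.
Arguments idm {k k0} c : rename.
Arguments comp {k k0 c d e} f g : rename.

Record subcat (k : fieldType) (C : klincat k) := Subcat {
  sub_hom :> forall c d : C, subspace (hom c d);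
  sub_idm : forall c, idm c \in subspace_pred (sub_hom c c);
  sub_comp : forall c d e (f : hom d e) (g : hom c d),
    f \in subspace_pred (sub_hom d e) -> g \in subspace_pred (sub_hom c d) ->
    comp f g \in subspace_pred (sub_hom c e) }.

Section SubcatCat.
Variables (k : fieldType) (C : klincat k) (S : subcat C).

Definition subcat_hom (c d : C) : lmodType k := sub_space (S c d).

Definition subcat_idm (c : C) : subcat_hom c c :=
  exist (fun f => f \in subspace_pred (S c c)) _ (sub_idm S c).

Definition subcat_comp (c d e : C) (f : subcat_hom d e) (g : subcat_hom c d) :
    subcat_hom c e :=
  exist (fun h => h \in subspace_pred (S c e)) _ (sub_comp (valP f) (valP g)).

Lemma subcat_comp_linearl c d e (g : subcat_hom c d) :
  linear (fun f : subcat_hom d e => subcat_comp f g).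
Proof. by move=> a x y; apply: val_inj; apply: comp_linearl. Qed.
Lemma subcat_comp_linearr c d e (f : subcat_hom d e) :
  linear (fun g : subcat_hom c d => subcat_comp f g).
Proof. by move=> a x y; apply: val_inj; apply: comp_linearr. Qed.
Lemma subcat_comp_assoc a b c d (f : subcat_hom c d) (g : subcat_hom b c)
    (h : subcat_hom a b) :
  subcat_comp f (subcat_comp g h) = subcat_comp (subcat_comp f g) h.
Proof. by apply: val_inj; apply: comp_assoc. Qed.
Lemma subcat_comp_idl c d (f : subcat_hom c d) : subcat_comp (subcat_idm d) f = f.
Proof. by apply: val_inj; apply: comp_idl. Qed.
Lemma subcat_comp_idr c d (f : subcat_hom c d) : subcat_comp f (subcat_idm c) = f.
Proof. by apply: val_inj; apply: comp_idr. Qed.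

Definition subcat_cat : klincat k :=
  KLinCat subcat_comp_linearl subcat_comp_linearr subcat_comp_assoc
    subcat_comp_idl subcat_comp_idr.
End SubcatCat.

Section FullSubcategory.
Variables (k : fieldType) (C : klincat k) (P : pred C).

Definition full_obj : choiceType := {c : C | P c}.

Definition full_cat : klincat k :=
  @KLinCat k full_obj (fun c d => hom (val c) (val d)) (fun c => idm (val c))
    (fun c d e => @comp k C (val c) (val d) (val e))
    (fun c d e => @comp_linearl k C (val c) (val d) (val e))
    (fun c d e => @comp_linearr k C (val c) (val d) (val e))
    (fun a b c d => @comp_assoc k C (val a) (val b) (val c) (val d))
    (fun c d => @comp_idl k C (val c) (val d))
    (fun c d => @comp_idr k C (val c) (val d)).

Definition full_subcat (S : subcat C) : subcat full_cat :=
  @Subcat k full_cat (fun c d => S (val c) (val d)) (fun c => sub_idm S (val c))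
    (fun c d e => @sub_comp k C S (val c) (val d) (val e)).
End FullSubcategory.

(* End(c) and k are isomorphic as k-algebras. *)
Definition end_is_base (k : fieldType) (D : klincat k) (c : D) : Prop :=
  exists phi : {linear k^o -> hom c c},
    [/\ bijective phi, phi 1 = idm c &
        forall a b : k, phi (a * b) = comp (phi a) (phi b)].

Definition direct (k : fieldType) (D : klincat k) (L : wotype) (deg : D -> L) : Prop :=
  (forall c : D, end_is_base c) /\
  (forall (c d : D) (f : hom c d), f != 0 -> c <> d -> wo_lt (deg c) (deg d)).

Definition inverse (k : fieldType) (D : klincat k) (L : wotype) (deg : D -> L) : Prop :=
  (forall c : D, end_is_base c) /\
  (forall (c d : D) (f : hom c d), f != 0 -> c <> d -> wo_lt (deg d) (deg c)).

Section CompositionMap.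
Variables (k : fieldType) (C : klincat k) (P M : subcat C).

(* The sum ranges over a family [o : J -> C] of objects, so that the same map
   serves for all objects ([o = id]) and for the objects of bounded degree
   ([o = val] on a subtype). *)
Definition comp_dsum (J : choiceType) (o : J -> C) (c d : C) : lmodType k :=
  dsum (fun j => tensor (sub_space (P (o j) d)) (sub_space (M c (o j)))).

Definition comp_summand (c d e : C) :
    tensor (sub_space (P e d)) (sub_space (M c e)) -> hom c d :=
  tensor_lift (fun (f : sub_space (P e d)) (g : sub_space (M c e)) =>
                 comp (val f) (val g)).

Definition comp_map (J : choiceType) (o : J -> C) (c d : C) :
    comp_dsum o c d -> hom c d :=
  dsum_lift (fun j => @comp_summand c d (o j)).
End CompositionMap.

Record reedy (k : fieldType) (C : klincat k) (L : wotype) := Reedy {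
  deg : C -> L;
  rplus : subcat C;
  rminus : subcat C;
  reedy_direct : direct (D := subcat_cat rplus) deg;
  reedy_inverse : inverse (D := subcat_cat rminus) deg;
  reedy_iso : forall c d : C,
    bijective (@comp_map k C rplus rminus C id c d) }.

Section Spanning.
Variable k : fieldType.

Lemma linear_0 (U V : lmodType k) (f : U -> V) : linear f -> f 0 = 0.
Proof. by move=> lf; have := lf (-1) 0 0; rewrite scaler0 addr0 scaleN1r addNr. Qed.

Lemma linear_comp (U V W : lmodType k) (f : U -> V) (g : V -> W) :
  linear f -> linear g -> linear (g \o f).
Proof. by move=> lf lg a x y; rewrite /= lf lg. Qed.

Lemma linear_id (U : lmodType k) : linear (@id U).
Proof. by []. Qed.

Lemma linear_cst0 (U V : lmodType k) : linear (fun _ : U => 0 : V).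
Proof. by move=> a x y; rewrite scaler0 addr0. Qed.

Lemma dsum_span (I : choiceType) (V : I -> lmodType k) (K : subspace (dsum V)) :
  (forall i v, dsum_inj V i v \in subspace_pred K) -> forall x, x \in subspace_pred K.
Proof.
move=> h x; have [A /dsum_decomp ->] := dsum_supp x.
by apply: rpred_sum => i _; exact: h.
Qed.

Lemma tensor_span (V W : lmodType k) (K : subspace (tensor V W)) :
  (forall v w, pure v w \in subspace_pred K) -> forall x, x \in subspace_pred K.
Proof.
move=> h x; rewrite -[x]quot_piK; move: (repr _) => {}x.
have [A /dsum_decomp ->] := dsum_supp x; rewrite linear_sum.
apply: rpred_sum => -[v w] _; move: (dsum_fun _ _) => a.
rewrite free_genZ.
by rewrite linearZ; apply: rpredZ; exact: h.
Qed.

Lemma preim_closed (U V : lmodType k) (f : U -> V) (K : subspace V) :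
  linear f -> submod_closed [pred x | f x \in subspace_pred K].
Proof.
move=> lf.
pose f' : {linear U -> V} := HB.pack f (GRing.isLinear.Build k U V *:%R f lf).
split=> [|a x y]; rewrite !inE; first by rewrite -[f]/(f' : _ -> _) linear0 rpred0.
by move=> fx fy; rewrite lf rpredD ?rpredZ.
Qed.
Definition preim (U V : lmodType k) (f : U -> V) (lf : linear f) (K : subspace V) :
  subspace U := Subspace (preim_closed K lf).

Lemma imset_closed (U V : lmodType k) (f : U -> V) :
  linear f -> submod_closed [pred y | `[< exists x, f x = y >]].
Proof.
move=> lf.
pose f' : {linear U -> V} := HB.pack f (GRing.isLinear.Build k U V *:%R f lf).
split=> [|a _ _ /asboolP[x <-] /asboolP[y <-]]; apply/asboolP.
  by exists 0; exact: (linear0 f').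
by exists (a *: x + y); rewrite lf.
Qed.
Definition image_space (U V : lmodType k) (f : U -> V) (lf : linear f) :
  subspace V := Subspace (imset_closed lf).
End Spanning.

Section DirectSumRestrict.
Variables (k : fieldType) (I : choiceType) (P : pred I) (V : I -> lmodType k).
Variables (U : lmodType k) (f : forall i, V i -> U).
Let J : choiceType := {i : I | P i}.
Let W (j : J) : lmodType k := V (val j).
Let g (j : J) : W j -> U := @f (val j).

Lemma dsum_restr_subproof (y : dsum V) :
  ((fun j => dsum_fun y (val j)) : dprod W) \in dsum_pred W.
Proof.
apply/asboolP.
apply: (@finite_preimage _ _ _ (fun j : J => val j) _ (dsum_finite y)).
by move=> i j _ _; exact: val_inj.
Qed.

Definition dsum_restr (y : dsum V) : dsum W :=
  exist (fun x : dprod W => x \in dsum_pred W) _ (dsum_restr_subproof y).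

Definition dsum_extend : dsum W -> dsum V :=
  dsum_lift (fun j : J => dsum_inj V (val j)).

Lemma dsum_restr_linear : linear dsum_restr.
Proof. by move=> a x y; apply: dsum_ext. Qed.

Lemma dsum_extend_linear : linear dsum_extend.
Proof. by apply: dsum_lift_linear => j; exact: (@dsum_inj_linear k I V (val j)). Qed.

Lemma dsum_extend_inj j v : dsum_extend (dsum_inj W j v) = dsum_inj V (val j) v.
Proof.
rewrite [LHS](@dsum_lift_inj k J W) // => i; exact: (@dsum_inj_linear k I V (val i)).
Qed.

Lemma dsum_restr_inj (j : J) (v : W j) :
  dsum_restr (dsum_inj V (val j) v) = dsum_inj W j v.
Proof.
apply: dsum_ext => i; rewrite -[LHS]/(dsum_fun (dsum_inj V (val j) v) (val i)).
have [<-|nji] := eqVneq j i; first by rewrite !dsum_inj_in.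
by rewrite !dsum_inj_out.
Qed.

Lemma dsum_extendK : cancel dsum_extend dsum_restr.
Proof.
apply: (@dsum_eq k J W _ (dsum_restr \o dsum_extend) id).
- exact: linear_comp dsum_extend_linear dsum_restr_linear.
- exact: linear_id.
by move=> i v; rewrite [LHS]/(dsum_restr (dsum_extend _)) dsum_extend_inj; exact: dsum_restr_inj.
Qed.

Hypothesis lf : forall i, linear (@f i).

Lemma dsum_lift_restr_bij : (forall i, ~~ P i -> forall v : V i, v = 0) ->
  bijective (dsum_lift f) -> bijective (dsum_lift g).
Proof.
move=> V0 [n nK mK].
have lg j : linear (@g j) by exact: lf.
have ex x : dsum_lift f (dsum_extend x) = dsum_lift g x.
  apply: (@dsum_eq k J W _ (dsum_lift f \o dsum_extend) (dsum_lift g)).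
  - by apply: linear_comp; [exact: dsum_extend_linear | exact: dsum_lift_linear].
  - exact: dsum_lift_linear.
  move=> i v; rewrite [LHS]/(dsum_lift f (dsum_extend _)) dsum_extend_inj.
  exact: (etrans (@dsum_lift_inj k I V U f (val i) v lf)
                 (esym (@dsum_lift_inj k J W U g i v lg))).
have re y : dsum_lift g (dsum_restr y) = dsum_lift f y.
  have l1 : linear (dsum_lift g \o dsum_restr).
    by apply: linear_comp; [exact: dsum_restr_linear | exact: dsum_lift_linear].
  have l2 : linear (dsum_lift f) by exact: dsum_lift_linear.
  apply: (@dsum_eq k I V _ _ _ l1 l2) => i v.
  have [Pi|nPi] := boolP (P i).
    rewrite [LHS]/(dsum_lift g (dsum_restr _)).
    rewrite (@dsum_restr_inj (exist _ i Pi) v).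
    exact: (etrans (@dsum_lift_inj k J W U g (exist _ i Pi) v lg)
                   (esym (@dsum_lift_inj k I V U f i v lf))).
  by rewrite (V0 i nPi v) (linear_0 (@dsum_inj_linear k I V i)) !linear_0.
exists (dsum_restr \o n) => x; first by rewrite -ex /= nK dsum_extendK.
by rewrite /= re mK.
Qed.
End DirectSumRestrict.

Section CompositionMapTheory.
Variables (k : fieldType) (C : klincat k) (P M : subcat C).

Lemma val_linear (V : lmodType k) (W : subspace V) : linear (val : sub_space W -> V).
Proof. by []. Qed.

Lemma comp_summand_bil (c d e : C) :
  (forall g : sub_space (M c e),
     linear (fun f : sub_space (P e d) => comp (val f) (val g))) *
  (forall f : sub_space (P e d),
     linear (fun g : sub_space (M c e) => comp (val f) (val g))).
Proof. by split=> x a y z; rewrite val_linear (comp_linearl, comp_linearr). Qed.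

Lemma comp_summand_linear (c d e : C) : linear (@comp_summand k C P M c d e).
Proof. by apply: tensor_lift_linear => x; apply comp_summand_bil. Qed.

Lemma comp_summand_pure (c d e : C) f g :
  @comp_summand k C P M c d e (pure f g) = comp (val f) (val g).
Proof. by apply: tensor_lift_pure => x; apply comp_summand_bil. Qed.

Variables (J : choiceType) (o : J -> C).

Lemma comp_map_linear (c d : C) : linear (@comp_map k C P M J o c d).
Proof. by apply: dsum_lift_linear => j; exact: comp_summand_linear. Qed.

Lemma comp_map_inj (c d : C) j t :
  @comp_map k C P M J o c d (dsum_inj _ j t) = comp_summand t.
Proof. by apply: dsum_lift_inj => i; exact: comp_summand_linear. Qed.

Lemma comp_map_span (c d : C) (K : subspace (hom c d)) :
  (forall j (f : hom (o j) d) (g : hom c (o j)),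
     f \in subspace_pred (P (o j) d) -> g \in subspace_pred (M c (o j)) ->
     comp f g \in subspace_pred K) ->
  forall t, @comp_map k C P M J o c d t \in subspace_pred K.
Proof.
move=> h t; suff : t \in subspace_pred (preim (@comp_map_linear c d) K) by [].
move: t; apply: dsum_span => j t.
suff : t \in subspace_pred (preim (@comp_summand_linear c d (o j)) K).
  by rewrite !inE comp_map_inj.
move: t; apply: tensor_span => f g.
by rewrite !inE comp_summand_pure; apply: h; exact: valP.
Qed.
End CompositionMapTheory.

Section ReedyBelow.
Variables (k : fieldType) (C : klincat k) (L : wotype) (R : reedy C L).
Variable beta : segment L.

Definition deg_below : pred C := fun c => deg R c \in seg_pred beta.

Definition cat_below : klincat k := full_cat deg_below.

Definition deg_restr (c : cat_below) : L := deg R (val c).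

Definition plus_restr : subcat cat_below := full_subcat deg_below (rplus R).
Definition minus_restr : subcat cat_below := full_subcat deg_below (rminus R).

Lemma direct_restr : direct (D := subcat_cat plus_restr) deg_restr.
Proof.
have [h1 h2] := reedy_direct R; split=> [c|c d f f0 cd]; first exact: (h1 (val c)).
by apply: (h2 (val c) (val d) f) => // /val_inj.
Qed.

Lemma inverse_restr : inverse (D := subcat_cat minus_restr) deg_restr.
Proof.
have [h1 h2] := reedy_inverse R; split=> [c|c d f f0 cd]; first exact: (h1 (val c)).
by apply: (h2 (val c) (val d) f) => // /val_inj.
Qed.

Lemma iso_restr (c d : cat_below) :
  bijective (@comp_map k cat_below plus_restr minus_restr cat_below id c d).
Proof.
apply: (@dsum_lift_restr_bij k C deg_below
  (fun e => tensor (sub_space (rplus R e (val d))) (sub_space (rminus R (val c) e)))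
  (hom (val c) (val d))
  (fun e => @comp_summand k C (rplus R) (rminus R) (val c) (val d) e)).
- by move=> e; exact: comp_summand_linear.
- move=> e ne t.
  apply: (@tensor_eq k _ _ _ id (fun=> 0)); [exact: linear_id|exact: linear_cst0|].
  move=> f g; have -> : g = 0; last exact: linear_0 (pure_linearr f).
  apply/eqP/negPn/negP => g0; have [_ h] := reedy_inverse R.
  have ce : val c <> e by move=> ce; move: ne; rewrite -ce (valP c).
  have lt := h (val c) e g g0 ce; move/negP: ne; apply.
  by apply: seg_down (wo_lt_le lt) _; exact: (valP c).
exact: reedy_iso.
Qed.

Definition reedy_below : reedy cat_below L :=
  Reedy direct_restr inverse_restr iso_restr.
End ReedyBelow.

(* Left modules: k-linear functors to k-vector spaces. *)
Record lmodule (k : fieldType) (D : klincat k) := LModule {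
  mod_obj :> D -> lmodType k;
  act : forall c d, hom c d -> mod_obj c -> mod_obj d;
  act_linearl : forall c d (x : mod_obj c), linear (fun f : hom c d => act f x);
  act_linearr : forall c d (f : hom c d), linear (act f);
  act_id : forall c (x : mod_obj c), act (idm c) x = x;
  act_comp : forall c d e (f : hom d e) (g : hom c d) (x : mod_obj c),
    act (comp f g) x = act f (act g x) }.
Arguments act {k D} l {c d} f x.

Definition module_iso (k : fieldType) (D : klincat k) (M N : lmodule D) : Prop :=
  exists phi : forall d, {linear M d -> N d},
    (forall d, bijective (phi d)) /\
    (forall c d (f : hom c d) (x : M c), phi d (act M f x) = act N f (phi c x)).

Record submodule (k : fieldType) (D : klincat k) (M : lmodule D) := Submodule {
  smod :> forall d, subspace (M d);
  smod_act : forall c d (f : hom c d) (x : M c),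
    x \in subspace_pred (smod c) -> act M f x \in subspace_pred (smod d) }.

Section SubModule.
Variables (k : fieldType) (D : klincat k) (M : lmodule D) (N : submodule M).

Definition sub_obj (d : D) : lmodType k := sub_space (N d).

Definition sub_act c d (f : hom c d) (x : sub_obj c) : sub_obj d :=
  exist (fun y => y \in subspace_pred (N d)) _ (smod_act f (valP x)).

Lemma sub_act_linearl c d (x : sub_obj c) : linear (fun f : hom c d => sub_act f x).
Proof. by move=> a f g; apply: val_inj; apply: act_linearl. Qed.
Lemma sub_act_linearr c d (f : hom c d) : linear (sub_act f).
Proof. by move=> a x y; apply: val_inj; apply: act_linearr. Qed.
Lemma sub_act_id c (x : sub_obj c) : sub_act (idm c) x = x.
Proof. by apply: val_inj; apply: act_id. Qed.
Lemma sub_act_comp c d e (f : hom d e) (g : hom c d) (x : sub_obj c) :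
  sub_act (comp f g) x = sub_act f (sub_act g x).
Proof. by apply: val_inj; apply: act_comp. Qed.

Definition sub_module : lmodule D :=
  LModule sub_act_linearl sub_act_linearr sub_act_id sub_act_comp.
End SubModule.

Section QuotModule.
Variables (k : fieldType) (D : klincat k) (M : lmodule D) (N : submodule M).

Definition quot_obj (d : D) : lmodType k := quot_space (N d).

Definition quot_act c d (f : hom c d) (x : quot_obj c) : quot_obj d :=
  quot_pi (N d) (act M f (repr (x : quot_space (N c)))).

Lemma quot_actE c d (f : hom c d) (x : M c) :
  quot_act f (quot_pi (N c) x) = quot_pi (N d) (act M f x).
Proof.
apply/eqP; rewrite quot_piE.
pose h : {linear M c -> M d} :=
  HB.pack (act M f) (GRing.isLinear.Build k _ _ *:%R (act M f) (@act_linearr k D M c d f)).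
rewrite -[act M f]/(h : _ -> _) -linearB; apply: smod_act.
by rewrite -quot_piE quot_piK.
Qed.

Lemma quot_act_linearl c d (x : quot_obj c) : linear (fun f : hom c d => quot_act f x).
Proof.
by move=> a f g; rewrite -[x]quot_piK !quot_actE act_linearl linearP.
Qed.
Lemma quot_act_linearr c d (f : hom c d) : linear (quot_act f).
Proof.
move=> a x y; rewrite -[x]quot_piK -[y]quot_piK -linearP !quot_actE.
by rewrite act_linearr linearP.
Qed.
Lemma quot_act_id c (x : quot_obj c) : quot_act (idm c) x = x.
Proof. by rewrite -[x]quot_piK quot_actE act_id. Qed.
Lemma quot_act_comp c d e (f : hom d e) (g : hom c d) (x : quot_obj c) :
  quot_act (comp f g) x = quot_act f (quot_act g x).
Proof. by rewrite -[x]quot_piK !quot_actE act_comp. Qed.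

Definition quot_module : lmodule D :=
  LModule quot_act_linearl quot_act_linearr quot_act_id quot_act_comp.
End QuotModule.

Section Subquotient.
Variables (k : fieldType) (D : klincat k) (M : lmodule D) (N' N : submodule M).

Definition meet_sub (d : D) : subspace (sub_module N' d) :=
  preim (@val_linear k (M d) (N' d)) (N d).

Lemma meet_sub_act c d (f : hom c d) (x : sub_module N' c) :
  x \in subspace_pred (meet_sub c) ->
  act (sub_module N') f x \in subspace_pred (meet_sub d).
Proof. exact: smod_act. Qed.

(* [N' / N], meant for [N] contained in [N']. *)
Definition subquotient : lmodule D :=
  quot_module (@Submodule k D (sub_module N') meet_sub meet_sub_act).
End Subquotient.

(* [D(c, -)] *)
Definition rep (k : fieldType) (D : klincat k) (c : D) : lmodule D :=
  @LModule k D (hom c) (fun d e f g => comp f g)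
    (fun d e g => @comp_linearl k D c d e g)
    (fun d e f => @comp_linearr k D c d e f)
    (fun d f => comp_idl f)
    (fun d e e' f g x => esym (comp_assoc f g x)).

Definition mod_restr (k : fieldType) (D : klincat k) (P : pred D) (M : lmodule D) :
    lmodule (full_cat P) :=
  @LModule k (full_cat P) (fun d => M (val d))
    (fun c d f x => act M (c := val c) (d := val d) f x)
    (fun c d => @act_linearl k D M (val c) (val d))
    (fun c d => @act_linearr k D M (val c) (val d))
    (fun c => @act_id k D M (val c))
    (fun c d e => @act_comp k D M (val c) (val d) (val e)).

Section Standard.
Variables (k : fieldType) (D : klincat k) (L : wotype) (R : reedy D L).

Section Ideal.
Variable alpha : segment L.

Let J : choiceType := {e : D | deg R e \in seg_pred alpha}.

(* [I_{< alpha}(c, d)]: the image of the composition map from the sum over the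
   objects of degree below [alpha]. *)
Definition ideal_lt (c d : D) : subspace (hom c d) :=
  image_space (@comp_map_linear k D (rplus R) (rminus R) J val c d).

Lemma ideal_lt_mem c d e (f : hom e d) (g : hom c e) :
  deg R e \in seg_pred alpha ->
  f \in subspace_pred (rplus R e d) -> g \in subspace_pred (rminus R c e) ->
  comp f g \in subspace_pred (ideal_lt c d).
Proof.
move=> he hf hg; apply/asboolP.
pose j : J := exist _ e he.
pose f' : sub_space (rplus R e d) :=
  exist (fun f => f \in subspace_pred (rplus R e d)) f hf.
pose g' : sub_space (rminus R c e) :=
  exist (fun g => g \in subspace_pred (rminus R c e)) g hg.
exists (dsum_inj _ j (pure f' g')).
by rewrite comp_map_inj comp_summand_pure.
Qed.

Lemma ideal_lt_comp c d d' (h : hom d d') (x : hom c d) :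
  x \in subspace_pred (ideal_lt c d) -> comp h x \in subspace_pred (ideal_lt c d').
Proof.
move=> /asboolP[t <-].
suff : comp_map t \in subspace_pred (preim (@comp_linearr k D c d d' h) (ideal_lt c d')).
  by [].
apply: comp_map_span => -[e he] /= f g hf hg.
rewrite -[_ \in _]/(comp h (comp f g) \in subspace_pred (ideal_lt c d')) comp_assoc.
have [n _ nK] := reedy_iso R e d'; rewrite -[comp h f]nK; move: (n _) => {}t.
suff : comp_map t \in subspace_pred (preim (@comp_linearl k D c e d' g) (ideal_lt c d')).
  by [].
apply: comp_map_span => e' f' g' hf' hg'.
rewrite -[_ \in _]/(comp (comp f' g') g \in subspace_pred (ideal_lt c d')) -comp_assoc.
have [g0|g0] := eqVneq g' 0.
  rewrite g0 (linear_0 (@comp_linearl k D c e e' g)).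
  by rewrite (linear_0 (@comp_linearr k D c e' d' f')) rpred0.
apply: ideal_lt_mem hf' _; last exact: sub_comp.
have [<-//|ee'] := eqVneq e e'.
have [_ h2] := reedy_inverse R.
pose g1 : subcat_hom (rminus R) e e' :=
  exist (fun g => g \in subspace_pred (rminus R e e')) g' hg'.
by apply: seg_down (wo_lt_le (h2 e e' g1 g0 _)) he; exact/eqP.
Qed.

Definition rep_ideal (c : D) : submodule (rep c) :=
  @Submodule k D (rep c) (ideal_lt c) (@ideal_lt_comp c).
End Ideal.

(* [Delta_c = D(c, -) / I_{< deg c}(c, -)]. *)
Definition standard (c : D) : lmodule D := quot_module (rep_ideal (seg_of (deg R c)) c).
End Standard.

(* The chain [F] is indexed by the ordinals at most (the order type of) [S],
   i.e. by the initial segments of [S]; [seg_full S] is that ordinal itself and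
   the elements [a] of [S] are the ordinals below it. *)
Definition filtered_by (k : fieldType) (D : klincat k) (X : lmodule D -> Prop)
    (M : lmodule D) : Prop :=
  exists (S : wotype) (F : segment S -> submodule M),
    [/\ (forall d x, x \in subspace_pred (F (seg_zero S) d) <-> x = 0),
        (forall d x, x \in subspace_pred (F (seg_full S) d)),
        (forall A B : segment S, {subset seg_pred A <= seg_pred B} ->
           forall d, {subset subspace_pred (F A d) <= subspace_pred (F B d)}),
        (forall A : segment S, seg_limit A -> forall d x,
           x \in subspace_pred (F A d) <->
           exists2 a, a \in seg_pred A & x \in subspace_pred (F (seg_of a) d)) &
        (forall a : S, exists2 N, X N &
           module_iso (subquotient (F (seg_succ a)) (F (seg_of a))) N)].

(* Main.v *)
(* Choose for every object e of C_{<beta}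
   a basis of C^-(c,e), and well-order the disjoint union of these bases so that
   the degree of e is nondecreasing.  The filtration is by the spans of the f g with
   f in C^+(e,-) and g in an initial segment of the bases.  These are submodules
   because h f = f' + i with f' in C^+ and i in I_{<deg e}, and i g only involves
   basis elements sitting at objects of smaller degree.  The step that adds g in
   C^-(c,e) is the image of right multiplication by g on C(e,-), which kills
   I_{<deg e}; nothing more dies, because C(c,d) is the direct sum of the
   C^+(e,d) (x) C^-(c,e), so a functional on C^-(c,e) that is 1 on g and 0 on the
   earlier basis elements extracts the coefficient of g. *)
From HB Require Import structures.
From mathcomp Require Import all_boot all_algebra.
From mathcomp Require Import boolp classical_sets wochoice.
Require Import Defs.

Set Implicit Arguments.
Unset Strict Implicit.
Unset Printing Implicit Defensive.

Import GRing.Theory.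
Local Open Scope ring_scope.

(** * Well-ordered types *)

Lemma wo_ltNge (L : wotype) (x y : L) : wo_lt x y = ~~ wo_le y x.
Proof.
apply/idP/idP => [/andP[xy nxy]|nyx].
  by apply: contra nxy => yx; apply/eqP/wo_le_anti; rewrite xy.
have /orP[xy|/(negP nyx)//] := wo_le_total x y.
by apply/andP; split=> //; apply: contraNneq nyx => ->; exact: wo_le_refl.
Qed.

Lemma wo_lt_le_trans (L : wotype) (x y z : L) : wo_lt x y -> wo_le y z -> wo_lt x z.
Proof. by rewrite !wo_ltNge => nyx yz; apply: contra nyx; exact: wo_le_trans. Qed.

Lemma seg_ofS (L : wotype) (x y : L) : wo_le x y ->
  {subset seg_pred (seg_of x) <= seg_pred (seg_of y)}.
Proof. by move=> xy z zx; exact: wo_lt_le_trans zx xy. Qed.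

Lemma wo_ind (L : wotype) (P : L -> Prop) :
  (forall x, (forall y, wo_lt y x -> P y) -> P x) -> forall x, P x.
Proof.
move=> IH x; apply: contrapT => nPx.
have [z /asboolP nPz mz] : exists2 z, z \in [pred x | `[< ~ P x >]] &
    forall y, y \in [pred x | `[< ~ P x >]] -> wo_le z y.
  by apply: (@wo_min L _ x); exact/asboolP.
apply: nPz; apply: IH => y; rewrite wo_ltNge => nzy.
by apply: contrapT => nPy; move/negP: nzy; apply; apply: mz; exact/asboolP.
Qed.

Section SubWellOrder.
Variables (L : wotype) (P : pred L).

Lemma sub_wo_wellP : well_order (relpre val (@wo_le L) : rel {x : L | P x}).
Proof.
apply: antisymmetric_well_order => [x y /wo_le_anti /val_inj //|A [x Ax]].
have [|z /asboolP[y Ay <-] mz] :=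
    @wo_min L [pred z | `[< exists2 y, y \in A & val y = z >]] (val x).
  by apply/asboolP; exists x.
by exists y; split=> // t At; apply: mz; apply/asboolP; exists t.
Qed.

Definition sub_wo : wotype := WoType sub_wo_wellP.
End SubWellOrder.

(** The order is lexicographic: degree first, ties broken by an arbitrary well-order of [T]. *)
Lemma refining_wo (L : wotype) (T : choiceType) (deg : T -> L) :
  exists W : rel T, well_order W /\
    forall x y, W x y -> wo_le (deg x) (deg y).
Proof.
have [r rP] := well_ordering_principle T.
pose T0 := WoType rP.
exists (fun x y => wo_lt (deg x) (deg y) || (deg x == deg y) && @wo_le T0 x y).
split; last first.
  by move=> x y /orP[/wo_lt_le//|/andP[/eqP -> _]]; exact: wo_le_refl.
apply: antisymmetric_well_order => [x y|A [x Ax]].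
  rewrite !wo_ltNge => /andP[/orP[xy|/andP[/eqP dxy xy]] /orP[yx|/andP[/eqP dyx yx]]].
  - by have := wo_le_total (deg x) (deg y); rewrite (negPf xy) (negPf yx).
  - by rewrite dyx wo_le_refl in xy.
  - by rewrite dxy wo_le_refl in yx.
  - by apply: (@wo_le_anti T0); rewrite xy.
have [|d /asboolP[y Ay dy] md] :=
    @wo_min L [pred d | `[< exists2 y, y \in A & deg y = d >]] (deg x).
  by apply/asboolP; exists x.
have [|z /andP[/= Az /eqP dz] mz] := @wo_min T0 [pred z in A | deg z == d] y.
  by rewrite inE /= Ay dy eqxx.
exists z; split=> // t At.
have dt : wo_le d (deg t) by apply: md; apply/asboolP; exists t.
rewrite /wo_lt dz dt; have [dtE|//] := eqVneq.
by apply: mz; rewrite inE /= At dtE eqxx.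
Qed.

(** * Spans and restriction of morphisms to subspaces *)

Lemma span_min (k : fieldType) (V : lmodType k) (X : classical_sets.set V) (W : subspace V) :
  (forall y, X y -> y \in subspace_pred W) ->
  {subset subspace_pred (span X) <= subspace_pred W}.
Proof. by move=> XW x /asboolP; apply. Qed.

Lemma span_ker (k : fieldType) (U V : lmodType k) (f : U -> V) (X : classical_sets.set U) x :
  linear f -> (forall y, X y -> f y = 0) -> x \in subspace_pred (span X) -> f x = 0.
Proof.
move=> lf Xf; have c0 : submod_closed (pred1 (0 : V)).
  by split=> [|a y z /eqP -> /eqP ->]; rewrite inE ?scaler0 ?addr0.
move=> /(span_min (W := preim lf (Subspace c0))) fx.
by apply/eqP; apply: fx => y /Xf /eqP.
Qed.

Definition to_sub (k : fieldType) (V : lmodType k) (W : subspace V) x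
    (xW : x \in subspace_pred W) : sub_space W :=
  exist (fun x => x \in subspace_pred W) x xW.

Lemma comp_subrK (k : fieldType) (C : klincat k) (c d e : C) (h f : hom d e) (g : hom c d) :
  comp h g = comp (h - f) g + comp f g.
Proof. by have := comp_linearl g 1 (h - f) f; rewrite !scale1r subrK. Qed.

(** * Separating a vector from a subspace by a functional *)

Section Separation.
Variables (k : fieldType) (V : lmodType k).

Lemma maximal_avoiding_subspace (W : subspace V) v : v \notin subspace_pred W ->
  exists2 H : subspace V,
    {subset subspace_pred W <= subspace_pred H} /\ v \notin subspace_pred H &
    forall H' : subspace V, {subset subspace_pred H <= subspace_pred H'} ->
      v \notin subspace_pred H' -> {subset subspace_pred H' <= subspace_pred H}.
Proof.
move=> vW.
pose R (X Y : {pred V}) := `[< {subset X <= Y} >].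
pose S (X : {pred V}) := `[< [/\ submod_closed X, {subset subspace_pred W <= X} & v \notin X] >].
have SW : subspace_pred W \in S by apply/asboolP; split=> //; exact: subspace_closed.
have Rtr : {in S & &, transitive R}.
  by move=> Y X Z _ _ _ /asboolP XY /asboolP YZ; apply/asboolP => x /XY/YZ.
have Rrefl : {in S, reflexive R} by move=> X _; apply/asboolP.
have [|H /asboolP[cH WH vH] mH] := Zorn's_lemma Rrefl Rtr; last first.
  exists (Subspace cH); first by split.
  move=> H' HH' vH'; apply/asboolP/mH; last exact/asboolP.
  by apply/asboolP; split=> // [|x /WH /HH'//]; exact: subspace_closed.
move=> C CS /wo_chainW/= Cch.
(* The upper bound is the union of the chain together with [W]; including [W] covers the empty
   chain. *)
pose Z (x : V) := `[< exists X, [/\ X \in S, X = subspace_pred W \/ X \in C & x \in X] >].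
have RW X : X \in S -> {subset subspace_pred W <= X} by move=> /asboolP[].
exists Z; last first.
  move=> X CX; apply/asboolP => x xX; apply/asboolP.
  by exists X; split; [exact: CS|right|].
apply/asboolP; split.
- split=> [|a x y /asboolP[X [SX CX xX]] /asboolP[Y [SY CY yY]]]; apply/asboolP.
    by exists (subspace_pred W); split; [|left|exact: rpred0].
  have [U [SU CU xU yU]] : exists U,
      [/\ U \in S, U = subspace_pred W \/ U \in C, x \in U & y \in U].
    case: CX => [XW|CX]; first by exists Y; split=> //; apply: RW; rewrite -?XW.
    case: CY => [YW|CY].
      by exists X; split=> //; [right | apply: RW; rewrite -?YW].
    have /orP[/asboolP XY|/asboolP YX] := Cch X Y CX CY.
      by exists Y; split=> //; [right | exact: XY].
    by exists X; split=> //; [right | exact: YX].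
  exists U; split=> //; have /asboolP[[_ cU] _ _] := SU; exact: cU.
- by move=> x xW; apply/asboolP; exists (subspace_pred W); split=> //; left.
- by apply/negP => /asboolP[X [/asboolP[_ _ /negP]]].
Qed.

(** Take [H] maximal among the subspaces that contain [W] and avoid [v]. Then every vector is
    congruent modulo [H] to exactly one multiple of [v], and [psi] is that coefficient. *)
Lemma separating_functional (W : subspace V) v : v \notin subspace_pred W ->
  exists psi : V -> k^o,
    [/\ linear psi, forall w, w \in subspace_pred W -> psi w = 0 & psi v = 1].
Proof.
move=> /maximal_avoiding_subspace[H [WH vH] mH].
have dec x : exists a : k, x - a *: v \in subspace_pred H.
  have [xH|xH] := boolP (x \in subspace_pred H).
    by exists 0; rewrite scale0r subr0.
  (* [K] is [H + k x]. If it avoids [v], maximality puts [x] in [H]; otherwise [v - a x] lies in [H]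
     with [a] nonzero, and dividing by [a] solves for [x]. *)
  pose K := [pred y | `[< exists a : k, y - a *: x \in subspace_pred H >]].
  have cK : submod_closed K.
    split=> [|a y z /asboolP[b yb] /asboolP[b' zb']]; apply/asboolP.
      by exists 0; rewrite scale0r subr0 rpred0.
    exists (a * b + b').
    have -> : a *: y + z - (a * b + b') *: x = a *: (y - b *: x) + (z - b' *: x).
      by rewrite scalerDl scalerBr scalerA opprD addrACA.
    by rewrite rpredD ?rpredZ.
  have HK : {subset subspace_pred H <= K}.
    by move=> y yH; apply/asboolP; exists 0; rewrite scale0r subr0.
  have xK : x \in K by apply/asboolP; exists 1; rewrite scale1r subrr rpred0.
  have [/asboolP[a va]|vK] := boolP (v \in K); last first.
    by have := mH (Subspace cK) HK vK x xK; rewrite (negPf xH).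
  have a0 : a != 0.
    by apply: contraNneq vH => a0; rewrite a0 scale0r subr0 in va.
  exists a^-1; rewrite -[X in X - _](scalerK a0) -scalerBr rpredZ //.
  by rewrite -opprB rpredN.
have uniq a b x : x - a *: v \in subspace_pred H -> x - b *: v \in subspace_pred H -> a = b.
  move=> xa xb; apply: contraNeq vH => ab.
  have : (a - b) *: v \in subspace_pred H.
    have -> : (a - b) *: v = (x - b *: v) - (x - a *: v).
      by rewrite scalerBl opprB [RHS]addrC addrA subrK.
    by rewrite rpredB.
  by move/(rpredZ (a - b)^-1); rewrite scalerA mulVf ?scale1r // subr_eq0.
have [psi psiP] := choice dec.
exists psi; split=> [a x y|w wW|].
- apply: (uniq _ (a * psi x + psi y) (a *: x + y)) => //=.
  have -> : a *: x + y - (a * psi x + psi y) *: v =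
      a *: (x - psi x *: v) + (y - psi y *: v).
    by rewrite scalerDl scalerBr scalerA opprD addrACA.
  by rewrite rpredD ?rpredZ.
- by apply: (uniq _ _ w) => //; rewrite scale0r subr0 WH.
- by apply: (uniq _ _ v) => //; rewrite scale1r subrr rpred0.
Qed.
End Separation.

(** * A criterion for identifying a subquotient *)

Section SubquotientIso.
Variables (k : fieldType) (D : klincat k) (M1 M : lmodule D).
Variables (K : submodule M1) (N' N : submodule M) (theta : forall d, M1 d -> M d).
Hypotheses (theta_linear : forall d, linear (@theta d))
  (theta_act : forall c d (f : hom c d) x, theta (act M1 f x) = act M f (theta x))
  (theta_sub : forall d x, @theta d x \in subspace_pred (N' d))
  (theta_ker : forall d x, (@theta d x \in subspace_pred (N d)) = (x \in subspace_pred (K d)))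
  (theta_surj : forall d y, y \in subspace_pred (N' d) ->
     exists x, y - @theta d x \in subspace_pred (N d)).

Let Q := subquotient N' N.
Let piQ d : sub_module N' d -> Q d := @quot_pi k (sub_module N' d) (meet_sub N' N d).

(** The map [theta] sends [M1] into [N'], is onto modulo [N], and pulls [N] back to [K]; so it
    induces [M1 / K] onto [N' / N]. The isomorphism given is the inverse of the induced map. *)
Lemma subquotient_iso : module_iso Q (quot_module K).
Proof.
have thetaB d x y : theta (x - y) = theta x - theta y :> M d.
  by rewrite addrC -scaleN1r theta_linear scaleN1r addrC.
have lift d (q : Q d) : exists x,
    val (repr (q : quot_space (meet_sub N' N d))) - @theta d x \in subspace_pred (N d).
  by apply: theta_surj; exact: valP.
(* A preimage is chosen for each class; [phiE] shows that its class modulo [K] does not depend on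
   the choice. *)
pose phi d (q : Q d) : quot_module K d := quot_pi (K d) (sval (cid (lift d q))).
have phiE d (y : sub_module N' d) x : val y - @theta d x \in subspace_pred (N d) ->
    phi d (piQ y) = quot_pi (K d) x.
  move=> yx; rewrite /phi; case: cid => x' /= yx'.
  apply/eqP; rewrite quot_piE -theta_ker thetaB.
  set y' := repr _ in yx'.
  have yy' : val y - val y' \in subspace_pred (N d).
    have : quot_pi (meet_sub N' N d) y == quot_pi (meet_sub N' N d) y'.
      by rewrite /y' quot_piK.
    by rewrite quot_piE.
  have -> : theta x' - theta x = (val y - theta x) - (val y - val y') - (val y' - theta x').
    by rewrite !opprB [X in _ = X + _]addrC subrKA [RHS]addrC subrKA.
  by apply: rpredB => //; exact: rpredB.
have surj d (q : Q d) : exists y : sub_module N' d, q = piQ y.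
  by exists (repr (q : quot_space (meet_sub N' N d))); rewrite /piQ quot_piK.
have piQ_linear d : linear (@piQ d).
  by move=> a x y; rewrite /piQ linearP.
have phi_linear d : linear (phi d).
  move=> a q q'; have [y ->] := surj d q; have [y' ->] := surj d q'.
  have [x yx] := theta_surj (valP y); have [x' yx'] := theta_surj (valP y').
  rewrite -piQ_linear (phiE _ _ (a *: x + x')).
    by rewrite (phiE _ _ _ yx) (phiE _ _ _ yx') linearP.
  have -> : val (a *: y + y') - theta (a *: x + x') =
      a *: (val y - theta x) + (val y' - theta x').
    by rewrite theta_linear scalerBr opprD addrACA.
  by rewrite rpredD ?rpredZ.
pose phi' d : {linear Q d -> quot_module K d} :=
  HB.pack (phi d) (GRing.isLinear.Build k _ _ *:%R (phi d) (@phi_linear d)).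
exists phi'.
split=> [d|c d f q] /=; last first.
  have [y ->] := surj c q; have [x yx] := theta_surj (valP y).
  rewrite (phiE _ _ _ yx).
  rewrite quot_actE [quot_act _ _]quot_actE.
  apply: phiE.
  rewrite theta_act -[val _]/(act M f (val y)).
  have : act M f (val y - theta x) \in subspace_pred (N d) by exact: smod_act.
  by rewrite addrC -scaleN1r act_linearr scaleN1r addrC.
pose thetaN d x : sub_module N' d := to_sub (@theta_sub d x).
exists (fun p => piQ (thetaN d (repr (p : quot_space (K d))))) => [q|p].
  have [y ->] := surj d q; have [x yx] := theta_surj (valP y).
  rewrite (phiE _ _ _ yx); apply/eqP; rewrite quot_piE.
  set x' := repr _.
  have : x' - x \in subspace_pred (K d) by rewrite -quot_piE quot_piK.
  rewrite -theta_ker thetaB => h.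
  have : (theta x' - theta x) - (val y - theta x) \in subspace_pred (N d) by rewrite rpredB.
  by rewrite opprB subrKA.
by rewrite (phiE _ _ (repr p)) ?quot_piK // subrr rpred0.
Qed.
End SubquotientIso.

(** * Decomposition of morphisms in a Reedy category *)

Section TriangularDecomposition.
Variables (k : fieldType) (D : klincat k) (L : wotype) (R : reedy D L).

Lemma minus_deg (c e : D) (g : hom c e) : g \in subspace_pred (rminus R c e) ->
  g != 0 -> c != e -> wo_lt (deg R e) (deg R c).
Proof.
move=> gM g0 /eqP ce; have [_ h] := reedy_inverse R.
exact: (h c e (to_sub gM)).
Qed.

Lemma plus_deg (e d : D) (f : hom e d) : f \in subspace_pred (rplus R e d) ->
  f != 0 -> e != d -> wo_lt (deg R e) (deg R d).
Proof.
move=> fP f0 /eqP ed; have [_ h] := reedy_direct R.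
exact: (h e d (to_sub fP)).
Qed.

Lemma minus_end (c : D) (g : hom c c) : g \in subspace_pred (rminus R c c) ->
  exists a, g = a *: idm c.
Proof.
move=> gM; have [h _] := reedy_inverse R; have [phi [[psi _ psiK] phi1 _]] := h c.
pose g' : subcat_hom (rminus R) c c := to_sub gM.
exists (psi g'); have -> : g = val (phi (psi g')) by rewrite psiK.
by rewrite -[X in phi X]mulr1 -[X in phi X]/(psi g' *: (1 : k^o)) linearZ phi1.
Qed.

(** Write [h] as a sum of products [f g] through objects [e']. If [e'] differs from [e], a nonzero
    [g] lowers the degree and the product is in the ideal; if [e'] is [e], then [g] is a scalar and
    the product is in the direct part. *)
Lemma hom_plus_ideal (e d : D) (h : hom e d) :
  exists2 f, f \in subspace_pred (rplus R e d) &
    h - f \in subspace_pred (ideal_lt R (seg_of (deg R e)) e d).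
Proof.
pose I := subspace_pred (ideal_lt R (seg_of (deg R e)) e d).
pose K := [pred h : hom e d | `[< exists2 f, f \in subspace_pred (rplus R e d) & h - f \in I >]].
have cK : submod_closed K.
  split=> [|a x y /asboolP[f fP fI] /asboolP[g gP gI]]; apply/asboolP.
    by exists 0; rewrite ?subrr; exact: rpred0.
  exists (a *: f + g); first by rewrite rpredD ?rpredZ.
  have -> : a *: x + y - (a *: f + g) = a *: (x - f) + (y - g).
    by rewrite scalerBr opprD addrACA.
  by rewrite rpredD ?rpredZ.
have [n _ nK] := reedy_iso R e d; apply/asboolP.
suff : h \in subspace_pred (Subspace cK) by [].
rewrite -(nK h); apply: comp_map_span => e' f g fP gM /=; apply/asboolP.
have [g0|g0] := eqVneq g 0.
  by exists 0; rewrite ?rpred0 // g0 (linear_0 (comp_linearr f)) subrr rpred0.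
have [ee'|ee'] := eqVneq e e'; last first.
  by exists 0; rewrite ?rpred0 // subr0; apply: ideal_lt_mem => //; exact: (minus_deg gM g0 ee').
move: f g fP gM g0; rewrite /= -ee' => f g fP gM _.
have [a ->] := minus_end gM.
exists (a *: f); first by rewrite rpredZ.
have -> : comp f (a *: idm e) = a *: f.
  have := comp_linearr f a (idm e) 0.
  by rewrite (linear_0 (comp_linearr f)) !addr0 comp_idr.
by rewrite subrr rpred0.
Qed.

(** The map [q] inverts the composition isomorphism, projects to the summand at [e], and applies
    $\mathrm{id} \otimes \psi$. *)
Lemma coefficient_map (c e d : D) (psi : sub_space (rminus R c e) -> k^o) : linear psi ->
  exists q : hom c d -> sub_space (rplus R e d),
    [/\ linear q,
        forall (f : sub_space (rplus R e d)) g, q (comp (val f) (val g)) = (psi g : k) *: f &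
        forall e' f (g : hom c e'), e' != e -> f \in subspace_pred (rplus R e' d) ->
          g \in subspace_pred (rminus R c e') -> q (comp f g) = 0].
Proof.
move=> psiL; have [n Kn nK] := reedy_iso R c d.
pose b (f : sub_space (rplus R e d)) g := (psi g : k) *: f.
have bl g : linear (b^~ g) by move=> a x y; rewrite /b scalerDr !scalerA mulrC.
have br f : linear (b f) by move=> a x y; rewrite /b psiL scalerDl scalerA.
have tL := tensor_lift_linear bl br.
have nL : linear n.
  by move=> a x y; apply: (can_inj Kn); rewrite comp_map_linear !nK.
have nE e' (f : sub_space (rplus R e' d)) (g : sub_space (rminus R c e')) :
    n (comp (val f) (val g)) =
    dsum_inj (fun e => tensor (sub_space (rplus R e d)) (sub_space (rminus R c e))) e' (pure f g).
  by apply: (can_inj Kn); rewrite nK comp_map_inj comp_summand_pure.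
exists (fun x => tensor_lift b (dsum_fun (n x) e)); split.
- by move=> a x y; rewrite nL dsum_funP tL.
- by move=> f g; rewrite nE dsum_inj_in tensor_lift_pure.
- move=> e' f g ne fP gM.
  rewrite (nE e' (to_sub fP) (to_sub gM)).
  by rewrite dsum_inj_out // (linear_0 tL).
Qed.
End TriangularDecomposition.

(** * The filtration along greedy terms *)

Section GreedyFiltration.
Variables (k : fieldType) (C : klincat k) (L : wotype) (R : reedy C L).
Variables (c : C) (beta : segment L).
Local Notation D := (cat_below R beta).
Local Notation RB := (reedy_below R beta).
Local Notation M := (mod_restr (deg_below R beta) (rep c)).

(** All vectors of all the spaces $C^-(c,e)$ are well-ordered at once; the bases are extracted from
    this order afterwards. *)
Definition below_terms : choiceType := {e : D & sub_space (rminus R c (val e))}.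

Local Notation term g := (Tagged (fun e : D => sub_space (rminus R c (val e))) g).

Variables (W : rel below_terms) (W_wo : well_order W).
Hypothesis W_deg : forall s t, W s t -> wo_le (deg RB (tag s)) (deg RB (tag t)).
Let T : wotype := WoType W_wo.

(* The greedy terms at a fixed object e form a basis of C^-(c,e): those vectors
   that are not in the span of the vectors preceding them. *)
Definition greedy (t : below_terms) : bool :=
  tagged t \notin subspace_pred
    (span (fun g => @wo_lt T (term g) t)).

Definition greedy_wo : wotype := @sub_wo T greedy.
Local Notation S := greedy_wo.
Implicit Types (A : segment S) (s : S).

Local Notation obj s := (tag (val s)).
Local Notation mor s := (val (tagged (val s))).

Definition filtration_gens A (d : D) (x : hom c (val d)) : Prop :=
  exists2 s, s \in seg_pred A &
    exists2 f, f \in subspace_pred (rplus R (val (obj s)) (val d)) & x = comp f (mor s).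

Definition filtration A (d : D) : subspace (M d) := span (@filtration_gens A d).

Lemma filtration_gen A s (d : D) f : s \in seg_pred A ->
  f \in subspace_pred (rplus R (val (obj s)) (val d)) ->
  comp f (mor s) \in subspace_pred (filtration A d).
Proof. by move=> sA fP; apply: span_sub; exists s => //; exists f. Qed.

Lemma filtrationS A B (d : D) : {subset seg_pred A <= seg_pred B} ->
  {subset subspace_pred (filtration A d) <= subspace_pred (filtration B d)}.
Proof.
move=> AB; apply: span_min => _ [s sA [f fP ->]].
by apply: filtration_gen => //; exact: AB.
Qed.

(** Greedy terms span, with control on position: by induction on [t], a term that is not greedy is a
    combination of earlier terms at the same object, so only greedy terms up to [t] occur. *)
Lemma filtration_upto A (d : D) (t : T) f :
  f \in subspace_pred (rplus R (val (tag t)) (val d)) ->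
  (forall s, @wo_le T (val s) t -> s \in seg_pred A) ->
  comp f (val (tagged t)) \in subspace_pred (filtration A d).
Proof.
elim/wo_ind: t f => t IH f fP tA.
have [gt|] := boolP (greedy t).
  apply: (@filtration_gen A (exist _ t gt)) => //.
  by apply: tA; exact: wo_le_refl.
rewrite negbK => tspan.
have lf : linear (fun g : sub_space (rminus R c (val (tag t))) => comp f (val g)).
  by move=> a x y; rewrite val_linear comp_linearr.
suff : tagged t \in subspace_pred (preim lf (filtration A d)) by [].
apply: span_min tspan => g gt.
apply: (IH (term g) gt) => // s sg.
by apply: tA; exact: wo_le_trans sg (wo_lt_le gt).
Qed.

(** Since the order refines the degree, every greedy term up to the term [g] at [e] comes strictly
    before [s]. The condition on [A] holds both for [seg_of s] and for any segment containing
    [s]. *)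
Lemma filtration_low A (d e : D) s f g :
  f \in subspace_pred (rplus R (val e) (val d)) ->
  g \in subspace_pred (rminus R c (val e)) ->
  wo_lt (deg RB e) (deg RB (obj s)) ->
  (forall s', wo_lt s' s -> s' \in seg_pred A) ->
  comp f g \in subspace_pred (filtration A d).
Proof.
move=> fP gM es sA.
apply: (@filtration_upto A d (term (to_sub gM))) => //.
move=> s' /W_deg s'e; apply: sA; rewrite wo_ltNge; apply/negP => /W_deg ss'.
move: es; rewrite wo_ltNge => /negP; apply; exact: wo_le_trans ss' s'e.
Qed.

(** A product [f g] in the ideal passes through an object [e] of degree below that of [s], and [g]
    composed with the vector of [s] stays in the inverse part, so the previous lemma applies. *)
Lemma filtration_ideal A (d : D) s (i : hom (obj s) d) :
  i \in subspace_pred (ideal_lt RB (seg_of (deg RB (obj s))) (obj s) d) ->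
  (forall s', wo_lt s' s -> s' \in seg_pred A) ->
  comp (i : hom (val (obj s)) (val d)) (mor s) \in subspace_pred (filtration A d).
Proof.
move=> /asboolP[t <-] sA.
have lg : linear (fun i : hom (obj s) d => comp (i : hom (val (obj s)) (val d)) (mor s) : M d).
  exact: (@comp_linearl k C c (val (obj s)) (val d) (mor s)).
suff : comp_map t \in subspace_pred (preim lg (filtration A d)) by [].
apply: comp_map_span => -[e es] f g fP gM.
suff : comp (comp (f : hom (val e) (val d)) (g : hom (val (obj s)) (val e))) (mor s)
    \in subspace_pred (filtration A d) by [].
rewrite -comp_assoc; apply: (@filtration_low A d e s) => //.
by apply: sub_comp => //; exact: valP.
Qed.

Lemma filtration_act A (c' d : D) (h : hom c' d) x :
  x \in subspace_pred (filtration A c') -> act M h x \in subspace_pred (filtration A d).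
Proof.
move=> xA; suff : x \in subspace_pred (preim (@act_linearr k D M c' d h) (filtration A d)).
  by [].
apply: span_min xA => _ [s sA [f fP ->]].
suff : comp (h : hom (val c') (val d)) (comp f (mor s)) \in subspace_pred (filtration A d).
  by [].
rewrite comp_assoc.
pose hf : hom (obj s) d := comp (h : hom (val c') (val d)) f.
have [f' f'P hf'] := @hom_plus_ideal k D L RB (obj s) d hf.
(* The part [f'] gives a generator at the same [s]; the rest is in the ideal and only needs terms
   before [s]. *)
rewrite (@comp_subrK k C c (val (obj s)) (val d) _ f').
apply: rpredD; last exact: filtration_gen.
by apply: filtration_ideal => // s' s's; exact: seg_down (wo_lt_le s's) sA.
Qed.

Definition filtration_mod A : submodule M := @Submodule k D M (filtration A) (@filtration_act A).

Lemma filtration0 (d : D) x : x \in subspace_pred (filtration (seg_zero S) d) <-> x = 0.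
Proof.
split=> [x0|->]; last exact: rpred0.
by apply: (span_ker (@linear_id k (M d)) _ x0) => y [].
Qed.

Lemma filtrationT (d : D) x : x \in subspace_pred (filtration (seg_full S) d).
Proof.
have [n _ nK] := reedy_iso R c (val d); rewrite -(nK x).
apply: (comp_map_span (K := filtration (seg_full S) d)) => e f g fP gM.
have [f0|f0] := eqVneq f 0.
  by rewrite f0 (linear_0 (comp_linearl g)) rpred0.
(* The isomorphism sums over all objects of [C], but a nonzero [f] from [e] to [d] in the direct
   part forces [e] into degree below [beta]. *)
have eb : deg_below R beta e.
  have [ed|ed] := eqVneq e (val d); first by rewrite ed; exact: (valP d).
  exact: seg_down (wo_lt_le (plus_deg fP f0 ed)) (valP d).
pose e' : D := exist _ e eb.
pose g' : sub_space (rminus R c (val e')) := to_sub gM.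
exact: (@filtration_upto _ d (term g')).
Qed.

Lemma filtration_limit A : seg_limit A -> forall (d : D) x,
  x \in subspace_pred (filtration A d) <->
  exists2 a, a \in seg_pred A & x \in subspace_pred (filtration (seg_of a) d).
Proof.
move=> [[a0 a0A] limA] d x; split=> [|[a aA]]; last first.
  by apply: filtrationS => b /wo_lt_le ba; exact: seg_down ba aA.
(* The union of the earlier stages is a subspace because the later of two indices serves both
   vectors; zero needs [A] to be nonempty. *)
pose K := [pred x : M d | `[< exists2 a, a \in seg_pred A &
                          x \in subspace_pred (filtration (seg_of a) d) >]].
have cK : submod_closed K.
  split=> [|b y z /asboolP[a aA ya] /asboolP[a' aA' za']]; apply/asboolP.
    by exists a0 => //; exact: rpred0.
  have [m [mA am a'm]] : exists m, [/\ m \in seg_pred A, wo_le a m & wo_le a' m].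
    have /orP[aa'|a'a] := wo_le_total a a'.
      by exists a'; split=> //; exact: wo_le_refl.
    by exists a; split=> //; exact: wo_le_refl.
  have [_ cF] := subspace_closed (filtration (seg_of m) d).
  exists m; first exact: mA.
  apply: cF; first by apply: filtrationS ya; exact: seg_ofS.
  by apply: filtrationS za'; exact: seg_ofS.
move=> xA; suff : x \in subspace_pred (Subspace cK) by move=> /asboolP.
apply: span_min xA => y [s sA [f fP ->]]; apply/asboolP.
(* The stage [seg_of b] uses only terms strictly before [b], so an element of [A] beyond [s] is
   required. *)
have [b bA sb] := limA s sA; exists b => //; exact: filtration_gen.
Qed.

(** The criterion is applied to right multiplication by the vector of [s], from the functor
    represented by its object. *)
Lemma filtration_succ s :
  module_iso (subquotient (filtration_mod (seg_succ s)) (filtration_mod (seg_of s)))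
             (standard RB (obj s)).
Proof.
apply: (@subquotient_iso k D (rep (obj s)) M
  (rep_ideal RB (seg_of (deg RB (obj s))) (obj s)) (filtration_mod (seg_succ s))
  (filtration_mod (seg_of s))
  (fun d (h : hom (val (obj s)) (val d)) => comp h (mor s))).
- by move=> d; exact: (@comp_linearl k C c (val (obj s)) (val d) (mor s)).
- by move=> c' d f x; rewrite /= comp_assoc.
- move=> d h.
  suff : act M (h : hom (obj s) d) (mor s) \in subspace_pred (filtration (seg_succ s) d) by [].
  apply: filtration_act; rewrite -(comp_idl (mor s)).
  apply: filtration_gen; [exact: wo_le_refl | exact: sub_idm].
- move=> d h; apply/idP/idP; last by move=> hI; exact: filtration_ideal.
  (* Modulo the ideal, [h] may be replaced by [f] in the direct part; it remains to see that [f]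
     vanishes. *)
  have [f fP hf] := @hom_plus_ideal k D L RB (obj s) d h.
  rewrite (@comp_subrK k C c (val (obj s)) (val d) _ f) => hs.
  have fs : comp (f : hom (val (obj s)) (val d)) (mor s)
      \in subspace_pred (filtration (seg_of s) d).
    move: hs; rewrite rpredDl //; exact: filtration_ideal.
  suff f0 : f = 0 by rewrite f0 subr0 in hf.
  (* Greediness says that the vector of [s] is outside the span of the earlier vectors at its
     object. Hence [q] kills the whole stage before [s] and yet returns [f]. *)
  have [psi [psiL psi0 psi1]] := separating_functional (valP s).
  have [q [qL qs q0]] := coefficient_map (val d) psiL.
  have qlow t f' : @wo_lt T t (val s) ->
      f' \in subspace_pred (rplus R (val (tag t)) (val d)) ->
      q (comp f' (val (tagged t))) = 0.
    case: t f' => e g f' ts f'P.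
    have [ee|ne] := eqVneq e (obj s); last first.
      by apply: q0 => //; exact: valP.
    subst e.
    rewrite (qs (to_sub f'P)).
    by rewrite psi0 ?scale0r //; apply: span_sub.
  have : q (comp (f : hom (val (obj s)) (val d)) (mor s)) = 0.
    by apply: (span_ker qL _ fs) => _ [s' s's [f' f'P ->]]; exact: qlow.
  rewrite (qs (to_sub (W := rplus R (val (obj s)) (val d)) fP)).
  by rewrite psi1 scale1r => /(congr1 val).
- move=> d x xs.
  (* Surjectivity modulo the stage before [s] is checked on generators: those at [s] have preimage
     [f], all others already lie in that stage and take preimage 0. *)
  pose K := [pred x : M d | `[< exists h : hom (val (obj s)) (val d),
       x - comp h (mor s) \in subspace_pred (filtration (seg_of s) d) >]].
  have cK : submod_closed K.
    split=> [|a y z /asboolP[h yh] /asboolP[h' zh']]; apply/asboolP.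
      by exists 0; rewrite (linear_0 (comp_linearl (mor s))) subrr; exact: rpred0.
    exists (a *: h + h'); rewrite comp_linearl.
    have -> : a *: y + z - (a *: comp h (mor s) + comp h' (mor s)) =
        a *: (y - comp h (mor s)) + (z - comp h' (mor s)).
      by rewrite scalerBr opprD addrACA.
    by have [_ cF] := subspace_closed (filtration (seg_of s) d); apply: cF.
  suff : x \in subspace_pred (Subspace cK) by move=> /asboolP.
  apply: span_min xs => _ [s' s's [f fP ->]]; apply/asboolP.
  have [s'E|ns] := eqVneq s' s.
    by subst s'; exists f; rewrite subrr; exact: rpred0.
  exists 0; rewrite (linear_0 (comp_linearl (mor s))) subr0.
  by apply: filtration_gen => //; apply/andP; split.
Qed.
End GreedyFiltration.

(** * Filtration of the restricted representable functor *)

Theorem theorem4p5 (k : fieldType) (C : klincat k) (L : wotype) (R : reedy C L)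
    (c : C) (alpha : L) (deg_c : deg R c = alpha) (beta : segment L) :
  filtered_by
    (fun N : lmodule (cat_below R beta) =>
       exists e : cat_below R beta,
         deg (reedy_below R beta) e \in seg_pred (seg_min (seg_succ alpha) beta) /\
         N = standard (reedy_below R beta) e)
    (mod_restr (deg_below R beta) (rep c)).
Proof.
have [W [W_wo W_deg]] :=
  @refining_wo L (below_terms R c beta) (fun t => deg (reedy_below R beta) (tag t)).
exists (greedy_wo W_wo), (filtration_mod W_deg); split.
- exact: filtration0.
- by move=> d x; exact: filtrationT.
- by move=> A B AB d; exact: filtrationS.
- exact: filtration_limit.
- move=> s; exists (standard (reedy_below R beta) (tag (val s))); last exact: filtration_succ.
  exists (tag (val s)); split=> //; apply/andP; split; last exact: (valP (tag (val s))).
  (* The bound by [alpha] holds because a nonzero morphism of the inverse part goes from [c] to the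
     object of [s]. *)
  suff : wo_le (deg R (val (tag (val s)))) (deg R c) by rewrite deg_c.
  have [<-|ce] := eqVneq c (val (tag (val s))); first exact: wo_le_refl.
  apply/wo_lt_le/(minus_deg (valP (tagged (val s)))) => //.
  (* A greedy vector is nonzero, as 0 lies in every span. *)
  apply: contraNneq (valP s) => g0.
  have -> : tagged (val s) = 0 by exact: val_inj.
  exact: rpred0.
Qed.
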